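(* For every Diophantine equation $D(\zeta_1,\ldots,\zeta_t)=\upsilon$, where $D$ is a polynomial with integer coefficients and zero constant term and $\upsilon\in\mathbb{Z}$, there exist a direct power $\mathbb{H}^n$ of the Heisenberg group $\mathbb{H}$, a finitely generated submonoid $M$ of $\mathbb{H}^n$, and an element $g(\upsilon)\in\mathbb{H}^n$ such that the equation $D(\zeta_1,\ldots,\zeta_t)=\upsilon$ is solvable in integers if and only if $g(\upsilon)\in M$. The exponent $n$, the element $g(\upsilon)$, and a finite generating set of $M$ are effectively determined (computable from the equation). The submonoid $M$ (and hence $n$) depends only on the polynomial $D$ and not on $\upsilon$.
   Context: The Heisenberg group $\mathbb{H}$ is the group of $3\times 3$ upper triangular integer matrices with ones on the diagonal; $\mathbb{H}^n$ is the direct product of $n$ copies of $\mathbb{H}$. A submonoid of a group is a subset containing the identity and closed under multiplication; it is finitely generated if it consists of all finite (possibly empty) products of elements from some fixed finite set. ''Effectively determined'' means that there is an algorithm producing the data (elements of $\mathbb{H}^n$ being given as $n$-tuples of integer matrices). *)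

(* Defs.v *)
From HB Require Import structures.
From mathcomp Require Import all_boot all_order all_algebra.
From mathcomp Require Import monoid mpoly.

Set Implicit Arguments.
Unset Strict Implicit.
Unset Printing Implicit Defensive.

Import Order.TTheory GRing.Theory Num.Theory.

Local Open Scope ring_scope.

Definition unitriangular (A : 'M[int]_3) : bool :=
  [forall i : 'I_3, forall j : 'I_3, (j <= i)%N ==> (A i j == (i == j)%:R)].

Record heisenberg : predArgType := Heisenberg {
  heisenberg_mx :> 'M[int]_3;
  _ : unitriangular heisenberg_mx }.

HB.instance Definition _ := [isSub for heisenberg_mx].
HB.instance Definition _ := [Choice of heisenberg by <:].

Lemma unitriangularP (A : 'M[int]_3) :
  reflect (forall i j : 'I_3, (j <= i)%N -> A i j = (i == j)%:R)
          (unitriangular A).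
Proof.
apply: (iffP forallP) => [H i j leji | H i].
  by have /forallP/(_ j)/implyP/(_ leji)/eqP := H i.
by apply/forallP => j; apply/implyP => /H ->.
Qed.

Lemma unitriangular1 : unitriangular 1.
Proof. by apply/unitriangularP => i j _; rewrite mxE. Qed.

Lemma unitriangularM (A B : 'M[int]_3) :
  unitriangular A -> unitriangular B -> unitriangular (A *m B).
Proof.
move=> /unitriangularP HA /unitriangularP HB; apply/unitriangularP => i j leji.
rewrite mxE (bigD1 i) //= HA // eqxx mul1r HB // big1 ?addr0 // => k neki.
case: (leqP k i) => [leki | ltik].
  by rewrite HA // eq_sym (negPf neki) mul0r.
rewrite (HB k j) ?(leq_trans leji (ltnW ltik)) //.
suff /negPf -> : k != j by rewrite mulr0.
by apply: contraTneq ltik => ->; rewrite -leqNgt.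
Qed.

(* The inverse of 1 + N is 1 - N + N^2, since N^3 = 0. *)
Definition unitriangular_inv (A : 'M[int]_3) : 'M[int]_3 :=
  let N : 'M[int]_3 := A - 1 in 1 - N + N * N.

Lemma unitriangular_nilp (A : 'M[int]_3) :
  unitriangular A -> let N : 'M[int]_3 := A - 1 in N * N * N = 0.
Proof.
move=> /unitriangularP HA N.
have N0 (i j : 'I_3) : (j <= i)%N -> N i j = 0.
  by move=> leji; rewrite !mxE HA // subrr.
apply/matrixP => i j; rewrite -mulrA -!mulmxE !mxE big1 // => k _.
case: (leqP k i) => [/N0 -> | ltik]; first by rewrite mul0r.
rewrite !mxE big1 ?mulr0 // => l _.
case: (leqP l k) => [/N0 -> | ltkl]; first by rewrite mul0r.
rewrite (N0 l j) ?mulr0 //; apply: (@leq_trans 2); first by rewrite -ltnS.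
by rewrite (leq_ltn_trans _ ltkl) // (leq_ltn_trans _ ltik).
Qed.

Lemma unitriangularV (A : 'M[int]_3) :
  unitriangular A -> unitriangular (unitriangular_inv A).
Proof.
move=> HA; apply/unitriangularP => i j leji; move/unitriangularP: HA => HA.
rewrite /unitriangular_inv -mulmxE !mxE HA // subrr subr0 big1 ?addr0 // => k _.
case: (leqP k i) => [leki | ltik]; first by rewrite !mxE HA // subrr mul0r.
by rewrite !mxE (HA k j) ?subrr ?mulr0 // (leq_trans leji (ltnW ltik)).
Qed.

Definition heisenberg_one := Heisenberg unitriangular1.
Definition heisenberg_mul (A B : heisenberg) :=
  Heisenberg (unitriangularM (valP A) (valP B)).
Definition heisenberg_inv (A : heisenberg) :=
  Heisenberg (unitriangularV (valP A)).

Lemma heisenberg_mulA : associative heisenberg_mul.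
Proof. by move=> A B C; apply: val_inj; rewrite /= mulmxA. Qed.

Lemma heisenberg_mul1 : left_id heisenberg_one heisenberg_mul.
Proof. by move=> A; apply: val_inj; rewrite /= mul1mx. Qed.

Lemma heisenberg_mul1r : right_id heisenberg_one heisenberg_mul.
Proof. by move=> A; apply: val_inj; rewrite /= mulmx1. Qed.

Lemma heisenberg_mulV :
  left_inverse heisenberg_one heisenberg_inv heisenberg_mul.
Proof.
move=> A; apply: val_inj; rewrite /= mulmxE /unitriangular_inv.
have := unitriangular_nilp (valP A) => /=; set N := _ - 1 => N3.
have -> : heisenberg_mx A = 1 + N by rewrite /N addrC subrK.
clearbody N; rewrite mulrDr mulr1 !mulrDl mul1r mulNr N3 addr0.
by rewrite addrACA subrK subrr addr0.
Qed.

Lemma heisenberg_mulVr :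
  right_inverse heisenberg_one heisenberg_inv heisenberg_mul.
Proof.
by move=> A; have /(congr1 val) /mulmx1C E := heisenberg_mulV A; apply: val_inj.
Qed.

HB.instance Definition _ :=
  isGroup.Build heisenberg heisenberg_mulA heisenberg_mul1 heisenberg_mul1r
    heisenberg_mulV heisenberg_mulVr.

(* [direct_power n] is H^n, with the componentwise product of [monoid]. *)
Definition direct_power (n : nat) := {ffun 'I_n -> heisenberg}.

HB.instance Definition _ n := Group.on (direct_power n).

Definition submonoid (G : groupType) (M : G -> Prop) : Prop :=
  M 1%g /\ forall x y : G, M x -> M y -> M (x * y)%g.

Definition generated_by (G : groupType) (M : G -> Prop) (S : seq G) : Prop :=
  forall x : G,
    M x <-> exists2 w : seq G, {subset w <= S} & x = (\prod_(y <- w) y)%g.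

(* Kleene's total recursive functions of several natural numbers.  The scheme
   [recursive_mu] is regular minimization: [f] is required to vanish somewhere
   for every value of the parameters, which yields exactly the total computable
   functions.  The defined function [h] is characterized by its recursion
   equations, so that the class is stable under pointwise equality. *)
Inductive recursive : forall k : nat, (k.-tuple nat -> nat) -> Prop :=
| recursive_zero : recursive (fun _ : 0.-tuple nat => 0%N)
| recursive_succ : recursive (fun x : 1.-tuple nat => (thead x).+1)
| recursive_proj k (i : 'I_k) : recursive (fun x : k.-tuple nat => tnth x i)
| recursive_comp k m (f : m.-tuple nat -> nat)
    (g : 'I_m -> k.-tuple nat -> nat) (h : k.-tuple nat -> nat) :
    recursive f -> (forall i, recursive (g i)) ->
    (forall x, h x = f [tuple g i x | i < m]) ->
    recursive h
| recursive_primrec k (f : k.-tuple nat -> nat) (g : k.+2.-tuple nat -> nat)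
    (h : k.+1.-tuple nat -> nat) :
    recursive f -> recursive g ->
    (forall x : k.-tuple nat, h [tuple of 0%N :: x] = f x) ->
    (forall n (x : k.-tuple nat),
       h [tuple of n.+1 :: x] = g [tuple of n :: h [tuple of n :: x] :: x]) ->
    recursive h
| recursive_mu k (f : k.+1.-tuple nat -> nat) (h : k.-tuple nat -> nat) :
    recursive f ->
    (forall x : k.-tuple nat, f [tuple of h x :: x] = 0%N) ->
    (forall (x : k.-tuple nat) n, (n < h x)%N -> f [tuple of n :: x] <> 0%N) ->
    recursive h.

(* Goedel numbers.  [CodeSeq.code] is a bijection from [seq nat] to [nat] and
   [code_int] one from [int] to [nat]; structured data are coded as sequences
   of the codes of their components. *)
Definition code_int (z : int) : nat :=
  match z with Posz n => n.*2 | Negz n => n.*2.+1 end.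

Definition code_heisenberg (A : heisenberg) : nat :=
  CodeSeq.code [seq code_int (A i j) | i <- enum 'I_3, j <- enum 'I_3].

Definition code_element (n : nat) (x : direct_power n) : nat :=
  CodeSeq.code [seq code_heisenberg (x i) | i <- enum 'I_n].

Definition code_generators (n : nat) (S : seq (direct_power n)) : nat :=
  CodeSeq.code [:: n; CodeSeq.code [seq code_element x | x <- S]].

(* The code of D lists its nonzero terms in increasing order of the monomials
   (the degree-lexicographic order of [mpoly]), so that it is a function of the
   polynomial itself. *)
Definition code_monomial (t : nat) (m : 'X_{1..t}) : nat :=
  CodeSeq.code [seq m i | i <- enum 'I_t].

Definition code_poly (t : nat) (D : {mpoly int[t]}) : nat :=
  CodeSeq.code
    [:: t; CodeSeq.code [seq CodeSeq.code [:: code_int D@_m; code_monomial m]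
                        | m <- sort <=%O (msupp D)]].

(* Main.v *)
Require Import Defs.
From mathcomp Require Import all_boot all_order all_algebra.
From mathcomp Require Import monoid mpoly.
From mathcomp Require Import zify ring.

Set Implicit Arguments.
Unset Strict Implicit.
Unset Printing Implicit Defensive.

Import Order.TTheory GRing.Theory Num.Theory.

Local Open Scope ring_scope.

(** Write an element of the Heisenberg group as (a, b, c), with c the corner
   entry, so that (a, b, c)(a', b', c') = (a + a', b + b', c + c' + a b').  The
   equation D = upsilon becomes a system X_k = X_d + X_a X_b + z.  The value of
   X_j is the signed number of occurrences of the generators of X_j in a word,
   and every X_j is given four copies, meant to occur in four successive blocks
   of the word.  In the coordinate of an equation the blocks contribute
   y^(X_b), x^(X_a), y^(-X_b), x^(-X_a), whose product is central with corner
   entry - X_a X_b; one more coordinate for each variable makes the second and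
   third copies agree.

   The order of the blocks is forced by three markers, each used exactly once.
   In the coordinate of a marker (0, 1, 0), the generators which must precede it are
   (-1, 0, 1) and those which must follow it are (1, 0, 0).  When these are equal
   in number the corner entry of the product is the number of misplaced ones, so
   it vanishes only for correctly ordered words.  Two further generators, trivial
   in all other coordinates, equalize the two numbers. *)

(** * Recursive functions on lists of parameters *)

(* A function of an unbounded list of parameters; missing parameters read as
   [0], so no arity bookkeeping is needed. *)
Definition rec_fun (F : seq nat -> nat) : Prop :=
  forall k, recursive (fun x : k.-tuple nat => F x).

(** Composing with all the projections changes nothing, and the composition scheme accepts any
    pointwise equal result. *)
Lemma recursive_ext k (f g : k.-tuple nat -> nat) :
  recursive f -> g =1 f -> recursive g.
Proof.
move=> rf e; apply: (recursive_comp (g := fun i x => tnth x i)) rf _ _.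
  by move=> i; apply: recursive_proj.
move=> x; rewrite e; congr f; apply: eq_from_tnth => i.
by rewrite tnth_mktuple.
Qed.

Lemma rec_fun_ext F G : rec_fun F -> F =1 G -> rec_fun G.
Proof. by move=> rF e k; apply: recursive_ext (rF k) _ => x; rewrite e. Qed.

Lemma rec_fun0 : rec_fun (fun=> 0%N).
Proof.
move=> k; apply: (recursive_comp (m := 0) (g := fun=> fun=> 0%N)
  recursive_zero) => //; by case.
Qed.

Lemma rec_fun_nth i : rec_fun (fun s => nth 0%N s i).
Proof.
move=> k; have [lt_ik | le_ki] := ltnP i k.
  apply: recursive_ext (recursive_proj (Ordinal lt_ik)) _ => x.
  by rewrite (tnth_nth 0%N).
apply: recursive_ext (rec_fun0 k) _ => x.
by rewrite nth_default // size_tuple.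
Qed.

(** For each arity [Gs] is a fixed finite list, so this is plain composition; its dependence on the
    arity allows a whole suffix of the parameters to be passed on. *)
Lemma rec_fun_map F (Gs : nat -> seq (seq nat -> nat)) :
  rec_fun F ->
  (forall k i, (i < size (Gs k))%N -> rec_fun (nth (fun=> 0%N) (Gs k) i)) ->
  rec_fun (fun s => F [seq G s | G <- Gs (size s)]).
Proof.
move=> rF rG k.
apply: (recursive_comp (g := fun (i : 'I_(size (Gs k))) x =>
  nth (fun=> 0%N) (Gs k) i x) (rF (size (Gs k)))) => [i | x]; first exact: rG.
rewrite size_tuple; congr F; apply: (@eq_from_nth _ 0%N).
  by rewrite size_map size_tuple.
move=> i; rewrite size_map => lt_i.
by rewrite (nth_map (fun=> 0%N)) // -(tnth_nth _ _ (Ordinal lt_i)) tnth_mktuple.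
Qed.

Definition params_from m k : seq (seq nat -> nat) :=
  [seq (fun s : seq nat => nth 0%N s i) | i <- iota m (k - m)].

Lemma params_fromE m s : [seq G s | G <- params_from m (size s)] = drop m s.
Proof.
rewrite -map_comp; apply: (@eq_from_nth _ 0%N).
  by rewrite size_map size_iota size_drop.
move=> i; rewrite size_map size_iota => lt_i.
by rewrite (nth_map 0%N) ?size_iota // nth_iota // nth_drop.
Qed.

Lemma rec_params_from m k i : (i < size (params_from m k))%N ->
  rec_fun (nth (fun=> 0%N) (params_from m k) i).
Proof.
rewrite size_map => lt_i; rewrite (nth_map 0%N) //; exact: rec_fun_nth.
Qed.

Lemma rec_fun_drop m F : rec_fun F -> rec_fun (fun s => F (drop m s)).
Proof.
move=> rF; apply: rec_fun_ext (rec_fun_map rF (@rec_params_from m)) _ => s.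
by rewrite params_fromE.
Qed.

Lemma rec_fun_cons_drop m F G :
  rec_fun F -> rec_fun G -> rec_fun (fun s => F (G s :: drop m s)).
Proof.
move=> rF rG.
apply: rec_fun_ext (rec_fun_map (Gs := fun k => G :: params_from m k) rF _) _.
  by move=> k [|i] //; apply: rec_params_from.
by move=> s; rewrite /= params_fromE.
Qed.

Lemma rec_fun_cons F G :
  rec_fun F -> rec_fun G -> rec_fun (fun s => F (G s :: s)).
Proof.
move=> rF rG; apply: rec_fun_ext (rec_fun_cons_drop 0 rF rG) _ => s.
by rewrite drop0.
Qed.

Lemma rec_fun_comp1 F G :
  rec_fun F -> rec_fun G -> rec_fun (fun s => F [:: G s]).
Proof.
by move=> rF rG; apply: (rec_fun_map (Gs := fun=> [:: G])) => // k [].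
Qed.

Lemma rec_fun_succ F : rec_fun F -> rec_fun (fun s => (F s).+1).
Proof.
move=> rF k; apply: (recursive_comp (g := fun=> fun x => F x) recursive_succ).
  by move=> i; apply: rF.
by move=> x; rewrite [thead _]tnth_mktuple.
Qed.

Lemma rec_fun_const n : rec_fun (fun=> n).
Proof. by elim: n => [|n IHn]; [apply: rec_fun0 | apply: rec_fun_succ]. Qed.

(** Primitive recursion whose step reads the counter at position 0, the accumulator at position 1
    and the original parameters from position 2 on. *)
Lemma rec_fun_iter N F G : rec_fun N -> rec_fun F -> rec_fun G ->
  rec_fun (fun s => nat_rec _ (F s) (fun n acc => G (n :: acc :: s)) (N s)).
Proof.
move=> rN rF rG.
pose R s := nat_rec (fun=> nat) (F (drop 1 s))
              (fun n acc => G (n :: acc :: drop 1 s)) (nth 0%N s 0).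
suff rR : rec_fun R.
  by apply: rec_fun_ext (rec_fun_cons rR rN) _ => s; rewrite /R /= drop0.
case=> [|k].
  (* Without parameters the counter reads as 0, so that [R] reduces to [F]. *)
  by apply: recursive_ext (rec_fun_drop 1 rF 0) _ => x; rewrite tuple0.
apply: (recursive_primrec (rF k) (rG k.+2)) => [x | n x];
  by rewrite /R /= drop0.
Qed.

Lemma rec_fun_mu F N : rec_fun F ->
  (forall s, F (N s :: s) = 0%N) ->
  (forall s n, (n < N s)%N -> F (n :: s) <> 0%N) ->
  rec_fun N.
Proof.
move=> rF N0 ltN k.
apply: (recursive_mu (rF k.+1)) => [x | x n]; first exact: N0.
exact: ltN.
Qed.

Lemma rec_fun_add F G : rec_fun F -> rec_fun G -> rec_fun (fun s => F s + G s)%N.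
Proof.
move=> rF rG.
apply: rec_fun_ext (rec_fun_iter rG rF (rec_fun_succ (rec_fun_nth 1))) _ => s.
by elim: (G s) => [|n /= ->]; rewrite ?addn0 ?addnS.
Qed.

Lemma rec_fun_mul F G : rec_fun F -> rec_fun G -> rec_fun (fun s => F s * G s)%N.
Proof.
move=> rF rG.
have rS := rec_fun_add (rec_fun_nth 1) (rec_fun_drop 2 rF).
apply: rec_fun_ext (rec_fun_iter rG rec_fun0 rS) _ => s.
by elim: (G s) => [|n /= ->]; rewrite ?muln0 //= drop0 mulnS addnC.
Qed.

Lemma rec_fun_pred F : rec_fun F -> rec_fun (fun s => (F s).-1).
Proof.
move=> rF.
apply: rec_fun_ext (rec_fun_iter rF rec_fun0 (rec_fun_nth 0)) _ => s.
by case: (F s).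
Qed.

Lemma rec_fun_sub F G : rec_fun F -> rec_fun G -> rec_fun (fun s => F s - G s)%N.
Proof.
move=> rF rG.
apply: rec_fun_ext (rec_fun_iter rG rF (rec_fun_pred (rec_fun_nth 1))) _ => s.
by elim: (G s) => [|n /= ->]; rewrite ?subn0 ?subnS.
Qed.

(** * Decidable conditions, and division by a constant *)

Definition rec_pred (P : seq nat -> bool) : Prop := rec_fun (fun s => P s : nat).

Lemma rec_fun_if P F G : rec_pred P -> rec_fun F -> rec_fun G ->
  rec_fun (fun s => if P s then F s else G s).
Proof.
move=> rP rF rG; have r1 := rec_fun_sub (rec_fun_const 1) rP.
apply: rec_fun_ext (rec_fun_add (rec_fun_mul rP rF) (rec_fun_mul r1 rG)) _ => s.
by case: (P s); rewrite /= ?mul1n ?mul0n ?addn0.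
Qed.

Lemma rec_pred_neg P : rec_pred P -> rec_pred (fun s => ~~ P s).
Proof.
move=> rP; apply: rec_fun_ext (rec_fun_sub (rec_fun_const 1) rP) _ => s.
by case: (P s).
Qed.

Lemma rec_pred_and P Q : rec_pred P -> rec_pred Q -> rec_pred (fun s => P s && Q s).
Proof.
by move=> rP rQ; apply: rec_fun_ext (rec_fun_mul rP rQ) _ => s; rewrite mulnb.
Qed.

Lemma rec_pred_or P Q : rec_pred P -> rec_pred Q -> rec_pred (fun s => P s || Q s).
Proof.
move=> rP rQ; have := rec_pred_neg (rec_pred_and (rec_pred_neg rP) (rec_pred_neg rQ)).
by move/rec_fun_ext; apply=> s; rewrite -negb_or negbK.
Qed.

Lemma rec_pred_leq F G : rec_fun F -> rec_fun G -> rec_pred (fun s => F s <= G s)%N.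
Proof.
move=> rF rG.
apply: rec_fun_ext (rec_fun_sub (rec_fun_const 1) (rec_fun_sub rF rG)) _ => s.
by rewrite /leq; case: (F s - G s)%N.
Qed.

Lemma rec_pred_eq F G : rec_fun F -> rec_fun G -> rec_pred (fun s => F s == G s).
Proof.
move=> rF rG; have := rec_pred_and (rec_pred_leq rF rG) (rec_pred_leq rG rF).
by move/rec_fun_ext; apply=> s; rewrite -eqn_leq.
Qed.

Lemma rec_fun_modn m F : rec_fun F -> rec_fun (fun s => F s %% m.+1)%N.
Proof.
move=> rF.
(* One step of a counter that returns to 0 after reaching [m]. *)
have rG : rec_fun (fun s => if nth 0%N s 1 == m then 0%N else (nth 0%N s 1).+1).
  apply: rec_fun_if; first exact: rec_pred_eq (rec_fun_nth _) (rec_fun_const _).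
    exact: rec_fun0.
  exact/rec_fun_succ/rec_fun_nth.
apply: rec_fun_ext (rec_fun_iter rF rec_fun0 rG) _ => s.
elim: (F s) => [|n /= ->]; first by rewrite mod0n.
rewrite modnS; suff -> : (m.+1 %| n.+1)%N = (n %% m.+1 == m)%N by [].
rewrite {1}(divn_eq n m.+1) -addnS dvdn_addr ?dvdn_mull //.
apply/idP/eqP => [/(dvdn_leq (ltn0Sn _)) | -> //].
by rewrite ltnS => le_mr; apply/eqP; rewrite eqn_leq le_mr -ltnS ltn_pmod.
Qed.

Lemma rec_fun_divn m F : rec_fun F -> rec_fun (fun s => F s %/ m.+1)%N.
Proof.
move=> rF; have rm := rec_fun_modn m (rec_fun_succ (rec_fun_nth 0)).
have rG : rec_fun _ := rec_pred_eq rm (rec_fun_const 0).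
apply: rec_fun_ext (rec_fun_iter rF rec_fun0 (rec_fun_add rG (rec_fun_nth 1))) _.
move=> s; elim: (F s) => [|n /= ->]; first by rewrite div0n.
by rewrite divnS.
Qed.

Lemma rec_fun_half F : rec_fun F -> rec_fun (fun s => (F s)./2).
Proof.
by move/(rec_fun_divn 1)/rec_fun_ext; apply=> s; rewrite divn2.
Qed.

Lemma rec_pred_odd F : rec_fun F -> rec_pred (fun s => odd (F s)).
Proof.
by move/(rec_fun_modn 1)/rec_fun_ext; apply=> s; rewrite modn2.
Qed.

(** * Lists coded as numbers *)

(** The exponent of 2 is the head and the odd part determines the tail, so every positive number
    codes exactly one pair and 0 is left for the empty list. *)
Definition code_cons (h x : nat) : nat := (2 ^ h * x.*2.+1)%N.
Definition code_head (n : nat) : nat := head 0%N (CodeSeq.decode n).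
Definition code_tail (n : nat) : nat := CodeSeq.code (behead (CodeSeq.decode n)).

Lemma code_cons_code h s : code_cons h (CodeSeq.code s) = CodeSeq.code (h :: s).
Proof. by []. Qed.

Lemma code_headK h x : code_head (code_cons h x) = h.
Proof.
by rewrite -[x]CodeSeq.decodeK code_cons_code /code_head CodeSeq.codeK.
Qed.

Lemma code_tailK h x : code_tail (code_cons h x) = x.
Proof.
by rewrite -[x in LHS]CodeSeq.decodeK code_cons_code /code_tail CodeSeq.codeK
           CodeSeq.decodeK.
Qed.

Variant code_spec : nat -> Type :=
| CodeNil : code_spec 0
| CodeCons h x : code_spec (code_cons h x).

Lemma codeP n : code_spec n.
Proof.
rewrite -[n]CodeSeq.decodeK; case: (CodeSeq.decode n) => [|h s]; constructor.
Qed.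

Lemma half_iter_code_cons h x : iter h half (code_cons h x) = x.*2.+1.
Proof.
rewrite /code_cons; elim: h => [|h IHh]; first by rewrite mul1n.
by rewrite iterSr expnS -mulnA mul2n doubleK.
Qed.

Lemma half_iter_code_cons_even h x i : (i < h)%N -> ~~ odd (iter i half (code_cons h x)).
Proof.
rewrite /code_cons; elim: i h => [|i IHi] [|h] //; rewrite ?ltnS => lt_ih.
  by rewrite /= expnS -mulnA mul2n odd_double.
by rewrite iterSr expnS -mulnA mul2n doubleK IHi.
Qed.

Lemma half_iter0 i : iter i half 0 = 0%N.
Proof. by elim: i => //= i ->. Qed.

Lemma rec_fun_half_iter F G : rec_fun F -> rec_fun G ->
  rec_fun (fun s => iter (F s) half (G s)).
Proof.
move=> rF rG.
apply: rec_fun_ext (rec_fun_iter rF rG (rec_fun_half (rec_fun_nth 1))) _ => s.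
by elim: (F s) => //= n ->.
Qed.

Lemma rec_fun_code_head F : rec_fun F -> rec_fun (fun s => code_head (F s)).
Proof.
have rhd : rec_fun (fun s => code_head (nth 0%N s 0)).
  (* The candidate is at position 0 and the code at position 1. The disjunct for the code 0, which
     never becomes odd under halving, makes the minimization regular. *)
  pose G s := let n := nth 0%N s 1 in
    (~~ ((n == 0) || odd (iter (nth 0 s 0) half n)) : nat)%N.
  apply: (rec_fun_mu (F := G)) => [|s|s i].
  - have r0 := rec_pred_eq (rec_fun_nth 1) (rec_fun_const 0).
    have r1 := rec_pred_odd (rec_fun_half_iter (rec_fun_nth 0) (rec_fun_nth 1)).
    exact: rec_pred_neg (rec_pred_or r0 r1).
  - rewrite /G /=; case: (codeP (nth 0%N s 0)) => // h x.
    by rewrite code_headK half_iter_code_cons /= odd_double orbT.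
  - rewrite /G /=; case: (codeP (nth 0%N s 0)) => // h x; rewrite code_headK => lt_ih.
    rewrite (negPf (half_iter_code_cons_even _ lt_ih)) orbF.
    by rewrite /code_cons muln_eq0 expn_eq0.
by move=> rF; apply: (rec_fun_comp1 rhd rF).
Qed.

(** Halving as often as the head says leaves 2x + 1, with x the code of the tail; one more halving
    leaves x. *)
Lemma rec_fun_code_tail F : rec_fun F -> rec_fun (fun s => code_tail (F s)).
Proof.
move=> rF; have := rec_fun_half (rec_fun_half_iter (rec_fun_code_head rF) rF).
move/rec_fun_ext; apply=> s; case: (codeP (F s)) => [|h x]; first by rewrite half_iter0.
by rewrite code_headK code_tailK half_iter_code_cons /= uphalf_double.
Qed.

Lemma rec_fun_code_cons F G : rec_fun F -> rec_fun G ->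
  rec_fun (fun s => code_cons (F s) (G s)).
Proof.
move=> rF rG; have rdbl H : rec_fun H -> rec_fun (fun s => (H s).*2).
  by move=> rH; apply: rec_fun_ext (rec_fun_add rH rH) _ => s; rewrite addnn.
apply: rec_fun_ext (rec_fun_iter rF (rec_fun_succ (rdbl _ rG)) (rdbl _ (rec_fun_nth 1))) _.
move=> s; rewrite /code_cons; elim: (F s) => [|n /= ->]; first by rewrite mul1n.
by rewrite expnS -mulnA mul2n.
Qed.

Lemma rec_fun_code_mkseq N F : rec_fun N -> rec_fun F ->
  rec_fun (fun s => CodeSeq.code (mkseq (fun i => F (i :: s)) (N s))).
Proof.
move=> rN rF.
(* Lists grow at the front, so the last entry is added first: step [n] adds the entry of index
   [N - n.+1]. *)
pose E s := (N (drop 2 s) - (nth 0 s 0).+1)%N.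
have rE : rec_fun E.
  exact: rec_fun_sub (rec_fun_drop 2 rN) (rec_fun_succ (rec_fun_nth 0)).
have rG := rec_fun_code_cons (rec_fun_cons_drop 2 rF rE) (rec_fun_nth 1).
apply: rec_fun_ext (rec_fun_iter rN rec_fun0 rG) _ => s.
rewrite /E /= drop0.
suff H m : (m <= N s)%N -> nat_rec (fun=> nat) 0%N (fun n acc =>
    code_cons (F ((N s - n.+1)%N :: s)) acc) m =
    CodeSeq.code [seq F (i :: s) | i <- iota (N s - m) m].
  by rewrite H // subnn.
elim: m => // m IHm lt_m /=; rewrite IHm ?(ltnW lt_m) //.
by rewrite -[in RHS]subSn // subSS.
Qed.

(** * The Heisenberg group in coordinates *)

Definition heis_matrix (a b c : int) : 'M[int]_3 :=
  \matrix_(i, j) nth 0 (nth [::] [:: [:: 1; a; c]; [:: 0; 1; b]; [:: 0; 0; 1]] i) j.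

Lemma heis_unitriangular a b c : unitriangular (heis_matrix a b c).
Proof.
by apply/unitriangularP => -[[|[|[|//]]] i] [[|[|[|//]]] j]; rewrite mxE.
Qed.

Definition heis a b c : heisenberg := Heisenberg (heis_unitriangular a b c).

Definition heis_a (A : heisenberg) : int := A ord0 (lift ord0 ord0).
Definition heis_b (A : heisenberg) : int := A (lift ord0 ord0) ord_max.
Definition heis_c (A : heisenberg) : int := A ord0 ord_max.

Lemma heis_aE a b c : heis_a (heis a b c) = a. Proof. by rewrite /heis_a mxE. Qed.
Lemma heis_bE a b c : heis_b (heis a b c) = b. Proof. by rewrite /heis_b mxE. Qed.
Lemma heis_cE a b c : heis_c (heis a b c) = c. Proof. by rewrite /heis_c mxE. Qed.
Definition heisE := (heis_aE, heis_bE, heis_cE).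

Lemma heisK A : heis (heis_a A) (heis_b A) (heis_c A) = A.
Proof.
apply: val_inj; apply/matrixP => i j; rewrite mxE.
have /unitriangularP HA := valP A.
case: i j => [[|[|[|//]]] lti] [[|[|[|//]]] ltj] //=; try (by rewrite HA);
  by congr (fun_of_matrix _ _ _); apply: val_inj.
Qed.

Lemma heis_aM A B : heis_a (A * B)%g = heis_a A + heis_a B.
Proof.
rewrite -[A]heisK -[B]heisK !heisE /heis_a mxE !big_ord_recl big_ord0 !mxE /=; ring.
Qed.
Lemma heis_bM A B : heis_b (A * B)%g = heis_b A + heis_b B.
Proof.
rewrite -[A]heisK -[B]heisK !heisE /heis_b mxE !big_ord_recl big_ord0 !mxE /=; ring.
Qed.
Lemma heis_cM A B : heis_c (A * B)%g = heis_c A + heis_c B + heis_a A * heis_b B.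
Proof.
rewrite -[A]heisK -[B]heisK !heisE /heis_c mxE !big_ord_recl big_ord0 !mxE /=; ring.
Qed.

Lemma heis1 : 1%g = heis 0 0 0.
Proof. by rewrite -[1%g]heisK; congr heis; rewrite /heis_a /heis_b /heis_c mxE. Qed.

(** The matrix is read row by row; 2 and 0 are the codes of its constant entries 1 and 0. *)
Lemma code_heis a b c : code_heisenberg (heis a b c) =
  CodeSeq.code [:: 2; code_int a; code_int c; 0; 2; code_int b; 0; 0; 2]%N.
Proof.
rewrite /code_heisenberg !enum_ordSl enum_ord0 /= !mxE //.
Qed.

(** * Recursive functions with values in the integers and in the Heisenberg group *)

Definition uncode_int (n : nat) : int := if odd n then Negz n./2 else Posz n./2.

Lemma uncode_intK n : code_int (uncode_int n) = n.
Proof.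
by rewrite -[RHS]odd_double_half /uncode_int; case: odd => /=; rewrite ?add1n.
Qed.

Lemma code_intK z : uncode_int (code_int z) = z.
Proof. by case: z => n; rewrite /uncode_int /= ?odd_double /= ?uphalf_double ?doubleK. Qed.

Definition rec_int (F : seq nat -> int) : Prop := rec_fun (fun s => code_int (F s)).
Definition rec_heis (F : seq nat -> heisenberg) : Prop :=
  rec_fun (fun s => code_heisenberg (F s)).

Lemma rec_int_const z : rec_int (fun=> z). Proof. exact: rec_fun_const. Qed.

Lemma rec_int_uncode F : rec_fun F -> rec_int (fun s => uncode_int (F s)).
Proof. by move/rec_fun_ext; apply=> s; rewrite uncode_intK. Qed.

Lemma rec_int_if P F G : rec_pred P -> rec_int F -> rec_int G ->
  rec_int (fun s => if P s then F s else G s).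
Proof.
by move=> rP rF rG; apply: rec_fun_ext (rec_fun_if rP rF rG) _ => s; case: ifP.
Qed.

(** For positive n the codes of n and -n are 2n and 2n - 1, so negation exchanges neighbours; the
    truncated predecessor fixes the code of 0. *)
Lemma rec_int_opp F : rec_int F -> rec_int (fun s => - F s).
Proof.
move=> rF; have r1 := rec_fun_if (rec_pred_odd rF) (rec_fun_succ rF) (rec_fun_pred rF).
apply: rec_fun_ext r1 _ => s.
by case: (F s) => [[|n]|n] /=; rewrite ?odd_double //= ?doubleS //= ?odd_double.
Qed.

Lemma rec_heis_if P F G : rec_pred P -> rec_heis F -> rec_heis G ->
  rec_heis (fun s => if P s then F s else G s).
Proof.
by move=> rP rF rG; apply: rec_fun_ext (rec_fun_if rP rF rG) _ => s; case: ifP.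
Qed.

Lemma rec_heis_heis F G H : rec_int F -> rec_int G -> rec_int H ->
  rec_heis (fun s => heis (F s) (G s) (H s)).
Proof.
move=> rF rG rH.
have r0 := rec_fun_code_cons (rec_fun_const 2) rec_fun0.
have r1 := rec_fun_code_cons rec_fun0 (rec_fun_code_cons rec_fun0 r0).
have r2 := rec_fun_code_cons (rec_fun_const 2) (rec_fun_code_cons rG r1).
have r3 := rec_fun_code_cons rH (rec_fun_code_cons rec_fun0 r2).
have r4 := rec_fun_code_cons (rec_fun_const 2) (rec_fun_code_cons rF r3).
by apply: rec_fun_ext r4 _ => s; rewrite code_heis.
Qed.

(** * Words *)

Section Words.
Variables (T : eqType) (f : T -> heisenberg).

Definition word_a (w : seq T) := \sum_(x <- w) heis_a (f x).
Definition word_b (w : seq T) := \sum_(x <- w) heis_b (f x).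
Definition word_c (w : seq T) := \sum_(x <- w) heis_c (f x).

(* [word_cross w] is the sum of [a_i * b_j] over the positions [i < j] of [w]. *)
Fixpoint word_cross (w : seq T) : int :=
  if w is x :: w' then heis_a (f x) * word_b w' + word_cross w' else 0.

Lemma word_prod w :
  (\prod_(x <- w) f x)%g = heis (word_a w) (word_b w) (word_c w + word_cross w).
Proof.
elim: w => [|x w IHw]; first by rewrite /word_a /word_b /word_c !big_nil heis1.
rewrite big_cons IHw -[LHS]heisK heis_aM heis_bM heis_cM !heisE.
rewrite /word_a /word_b /word_c !big_cons /= /word_b; congr heis; ring.
Qed.

Lemma word_cross_cat u v :
  word_cross (u ++ v) = word_cross u + word_cross v + word_a u * word_b v.
Proof.
elim: u => [|x u IHu] /=; first by rewrite /word_a big_nil mul0r add0r addr0.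
rewrite IHu /word_a /word_b big_cons big_cat /=; ring.
Qed.

Lemma word_cross0 w : (forall x, x \in w -> heis_b (f x) = 0) -> word_cross w = 0.
Proof.
elim: w => //= x w IHw H; rewrite IHw => [|y yw]; last by apply: H; rewrite inE yw orbT.
rewrite /word_b big_seq big1 ?mulr0 ?addr0 // => y yw.
by apply: H; rewrite inE yw orbT.
Qed.

End Words.

(** * Encoding systems of equations X_k = X_d + X_a * X_b + z *)

Definition row_sign (e : nat) : int := if odd e then -1 else 1.

Definition tie_entry (j q e : nat) : heisenberg :=
  if (q == 0%N) || (q != j) then heis 0 0 0
  else if e./2 == 1%N then heis (row_sign e) 0 0
  else if e./2 == 2%N then heis (- row_sign e) 0 0
  else heis 0 0 0.

(** The linear part X_k - X_d is carried by the corner entries of block 1 alone, and cancels when k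
    = d. *)
Definition equation_entry (k d a b q e : nat) : heisenberg :=
  if q == 0%N then heis 0 0 0 else
  heis (if q == a then
          if e./2 == 1%N then row_sign e
          else if e./2 == 3%N then - row_sign e else 0
        else 0)
       (if q == b then
          if e./2 == 0%N then row_sign e
          else if e./2 == 2%N then - row_sign e else 0
        else 0)
       (if e./2 == 1%N then
          if q == k then if q == d then 0 else row_sign e
          else if q == d then - row_sign e else 0
        else 0).

Definition marker_entry (i q e : nat) : heisenberg :=
  if q == 0%N then
    if (e %% 3 == i)%N then
      if (e %/ 3 == 0)%N then heis 0 1 0
      else if (e %/ 3 == 1)%N then heis (-1) 0 1
      else heis 1 0 0
    else heis 0 0 0
  else if (e./2 <= i)%N then heis (-1) 0 1 else heis 1 0 0.

(* Generator [9 * q + e] with [0 < q] is the copy of X_q of sign [(-1) ^ e] in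
   block [e./2] (the fifth block [e = 8] is trivial in the equations); with
   [q = 0] it is, according to [e %/ 3], the marker [e %% 3] or one of the two
   generators balancing its coordinate. *)
Definition row_var (r : nat) : nat := (r %/ 9)%N.
Definition row_kind (r : nat) : nat := (r %% 9)%N.

(** Rows with [row_var r = 0] are markers or balancing generators and count for no variable;
    variable 0 therefore always has value 0 and serves as a blank in the equations. *)
Definition row_count (j B r : nat) : int :=
  if [&& 0 < row_var r, row_var r == j & (row_kind r)./2 == B]%N then row_sign (row_kind r) else 0.

Definition occ (j B : nat) (w : seq nat) : int := \sum_(r <- w) row_count j B r.

Lemma occ_cons j B r w : occ j B (r :: w) = row_count j B r + occ j B w.
Proof. by rewrite /occ big_cons. Qed.

Lemma occ_cat j B u v : occ j B (u ++ v) = occ j B u + occ j B v.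
Proof. by rewrite /occ big_cat. Qed.

Lemma row_count_small j B r : (r < 9)%N -> row_count j B r = 0.
Proof. by move=> lt_r; rewrite /row_count /row_var divn_small. Qed.

Lemma tie_entryE j r (A := tie_entry j (row_var r) (row_kind r)) :
  [/\ heis_a A = row_count j 1 r - row_count j 2 r, heis_b A = 0 & heis_c A = 0].
Proof.
rewrite {}/A /tie_entry /row_count lt0n; case: eqP => //= _.
  by rewrite !heisE subr0.
case: eqP => //= _; last by rewrite !heisE subr0.
case: eqP => [->|_] /=; first by rewrite !heisE subr0.
by case: eqP => /= _; rewrite !heisE ?sub0r ?subr0.
Qed.

Lemma equation_entryE k d a b r (A := equation_entry k d a b (row_var r) (row_kind r)) :
  [/\ heis_a A = row_count a 1 r - row_count a 3 r,
      heis_b A = row_count b 0 r - row_count b 2 r &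
      heis_c A = row_count k 1 r - row_count d 1 r].
Proof.
rewrite {}/A /equation_entry /row_count lt0n; case: eqP => //= _.
  by rewrite !heisE subr0.
rewrite !heisE; split.
- case: eqP => //= _; case: eqP => [->|_] /=; first by rewrite subr0.
  by case: eqP => /= _; rewrite ?sub0r ?subr0.
- case: eqP => //= _; case: eqP => [->|_] /=; first by rewrite subr0.
  by case: eqP => /= _; rewrite ?sub0r ?subr0.
case: ((row_kind r)./2 == 1%N); rewrite ?andbT ?andbF ?subr0 //.
by case: eqP => _; case: eqP => _; rewrite ?subrr ?sub0r ?subr0.
Qed.

(** * Markers and the order of the blocks *)

Definition must_precede (i r : nat) : bool :=
  (r == 3 + i)%N || (9 <= r)%N && ((row_kind r)./2 <= i)%N.
Definition must_follow (i r : nat) : bool :=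
  (r == 6 + i)%N || (9 <= r)%N && (i < (row_kind r)./2)%N.

Lemma marker_entryE i r (A := marker_entry i (row_var r) (row_kind r)) : (i < 3)%N ->
  [/\ heis_a A = (must_follow i r)%:R - (must_precede i r)%:R,
      heis_b A = (r == i)%:R & heis_c A = (must_precede i r)%:R].
Proof.
move=> lt_i; rewrite {}/A /marker_entry /must_follow /must_precede.
case: (ltnP r 9) => [lt_r | le_r].
  rewrite /row_var /row_kind divn_small // (modn_small lt_r).
  case: i lt_i => [|[|[|//]]] _;
    move: lt_r; do 9?[case: r => [|r]] => // _; by rewrite /= ?heisE.
have -> : (row_var r == 0)%N = false by rewrite /row_var; lia.
have -> : (r == 3 + i)%N = false by lia.
have -> : (r == 6 + i)%N = false by lia.
have -> : (r == i)%N = false by lia.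
by case: leqP => /= _; rewrite !heisE ?subr0 ?sub0r.
Qed.

Lemma sum_indicator (P : pred nat) w : \sum_(r <- w) (P r)%:R = (count P w)%:R :> int.
Proof. by elim: w => [|r w IHw]; rewrite ?big_nil // big_cons IHw /= natrD. Qed.

Section Marker.
Variables (i : nat) (lt_i : (i < 3)%N).
Let f r := marker_entry i (row_var r) (row_kind r).

Lemma marker_word_a w :
  word_a f w = (count (must_follow i) w)%:R - (count (must_precede i) w)%:R.
Proof.
rewrite -!sum_indicator -sumrB; apply: eq_bigr => r _.
by case: (marker_entryE r lt_i).
Qed.

Lemma marker_word_b w : word_b f w = (count_mem i w)%:R.
Proof.
by rewrite -!sum_indicator; apply: eq_bigr => r _; case: (marker_entryE r lt_i).
Qed.

Lemma marker_word_c w : word_c f w = (count (must_precede i) w)%:R.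
Proof.
by rewrite -!sum_indicator; apply: eq_bigr => r _; case: (marker_entryE r lt_i).
Qed.

Lemma must_precede_marker : must_precede i i = false.
Proof. by rewrite /must_precede; lia. Qed.

Lemma must_follow_marker : must_follow i i = false.
Proof. by rewrite /must_follow; lia. Qed.

(* Every row on the wrong side of the marker adds [1] to the corner entry. *)
Lemma marker_word_corner (u v : seq nat) : i \notin u -> i \notin v ->
  word_c f (u ++ i :: v) + word_cross f (u ++ i :: v) =
  (count (must_follow i) u + count (must_precede i) v)%:R.
Proof.
move=> iu iv.
have cross0 (t : seq nat) : i \notin t -> word_cross f t = 0.
  move=> it; apply: word_cross0 => r rt; case: (marker_entryE r lt_i) => _ -> _.
  by case: eqP => // ri; rewrite -ri rt in it.
rewrite marker_word_c word_cross_cat /= !cross0 // marker_word_a.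
rewrite !(marker_word_b (_ :: _), marker_word_b v) /f; case: (marker_entryE i lt_i) => -> _ _.
rewrite must_precede_marker must_follow_marker count_cat /= must_precede_marker.
have -> : count_mem i v = 0%N by apply/count_memPn.
rewrite /= eqxx !natrD /= mulr1n; ring.
Qed.

(** The entry b = 1 says that the marker occurs exactly once; the corner entry is then a number of
    misplaced rows, so its vanishing leaves none. *)
Lemma marker_prod_split w : (\prod_(r <- w) f r)%g = heis 0 1 0 ->
  exists u v, [/\ w = u ++ i :: v, ~~ has (must_follow i) u &
                  ~~ has (must_precede i) v].
Proof.
rewrite word_prod => e.
have := congr1 heis_b e; rewrite !heisE marker_word_b => /eqP.
rewrite pnatr_eq1 => /eqP c1.
have iw : i \in w by rewrite -has_pred1 has_count c1.
case/splitPr: iw e c1 => u v e c1.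
have [iu iv] : i \notin u /\ i \notin v.
  move: c1; rewrite count_cat /= eqxx addnCA add1n => -[/eqP].
  by rewrite addn_eq0 => /andP[/eqP ? /eqP ?]; split; apply/count_memPn.
have := congr1 heis_c e; rewrite !heisE marker_word_corner // => /eqP.
rewrite pnatr_eq0 addn_eq0 => /andP[/eqP fu /eqP pv].
by exists u, v; rewrite !has_count fu pv.
Qed.

Lemma split_marker_prod u v (w := u ++ i :: v) : i \notin u -> i \notin v ->
  ~~ has (must_follow i) u -> ~~ has (must_precede i) v ->
  count (must_follow i) w = count (must_precede i) w ->
  (\prod_(r <- w) f r)%g = heis 0 1 0.
Proof.
move=> iu iv; rewrite !has_count -!eqn0Ngt => /eqP fu /eqP pv balanced.
rewrite word_prod marker_word_a balanced subrr marker_word_b marker_word_corner //.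
rewrite fu pv count_cat /= eqxx.
have -> : count_mem i v = 0%N by apply/count_memPn.
by have -> : count_mem i u = 0%N by apply/count_memPn.
Qed.

End Marker.

(** The splitting of a word at a marker is recast as a condition on pairs of positions, which passes
    to tails and so suits an induction on the word. *)
Definition marker_order (i r s : nat) : bool := ~~ (must_follow i r && must_precede i s).

Lemma split_marker_order i u v : (i < 3)%N ->
  ~~ has (must_follow i) u -> ~~ has (must_precede i) v ->
  pairwise (marker_order i) (u ++ i :: v).
Proof.
move=> lt_i fu; elim: u fu => [|r u IHu] /=.
  move=> _ pv; apply/andP; split.
    by apply/allP => s _; rewrite /marker_order must_follow_marker.
  elim: v pv => //= s v IHv; rewrite negb_or => /andP[_ pv].
  rewrite IHv // andbT; apply/allP => t tv; rewrite /marker_order.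
  by rewrite (negPf (hasPn pv t tv)) andbF.
rewrite negb_or => /andP[fr fu] pv; rewrite IHu // andbT.
by apply/allP => s _; rewrite /marker_order (negPf fr).
Qed.

(** A row of block B > i must follow marker i, so no row of a block G <= i can come after it. *)
Lemma occ_ordered i a b B G r w : pairwise (marker_order i) (r :: w) ->
  (G <= i < B)%N -> row_count a B r * occ b G w = 0.
Proof.
rewrite /= => /andP[/allP ord _] /andP[leGi ltiB]; rewrite {1}/row_count.
case: and3P => [[r0 _ /eqP rB]|_]; last by rewrite mul0r.
rewrite /occ big_seq big1 ?mulr0 // => s /ord; rewrite /marker_order /row_count.
case: and3P => // -[s0 _ /eqP sG].
rewrite /must_follow /must_precede rB sG leGi ltiB !andbT.
have -> : (9 <= r)%N by move: r0; rewrite /row_var; lia.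
have -> : (9 <= s)%N by move: s0; rewrite /row_var; lia.
by rewrite !orbT.
Qed.

(** In an ordered word the only x-rows standing before y-rows are those of block 1 before those of
    block 2, where the exponents of y are negated. *)
Lemma equation_word_cross k d a b w :
  (forall i, (i < 3)%N -> pairwise (marker_order i) w) ->
  word_cross (fun r => equation_entry k d a b (row_var r) (row_kind r)) w =
  - (occ a 1 w * occ b 2 w).
Proof.
elim: w => [|r w IHw] ord; first by rewrite /occ /= !big_nil mul0r oppr0.
have {}IHw := IHw (fun i lt_i => proj2 (andP (ord i lt_i))).
rewrite /= IHw !occ_cons.
have -> : word_b (fun r => equation_entry k d a b (row_var r) (row_kind r)) w =
          occ b 0 w - occ b 2 w.
  rewrite /occ -sumrB; apply: eq_bigr => s _.
  by case: (equation_entryE k d a b s).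
case: (equation_entryE k d a b r) => -> _ _.
(* [e1], [e2] and [e3] remove every other product of an x-row with a later y-row. [e4] and [e5]
   remove the surplus terms in the product of the two counts: a row of block 2 before block 1, and a
   row lying in both blocks. *)
have e1 := occ_ordered a b (ord 0 isT) (isT : 0 <= 0 < 1)%N.
have e2 := occ_ordered a b (ord 0 isT) (isT : 0 <= 0 < 3)%N.
have e3 := occ_ordered a b (ord 2 isT) (isT : 2 <= 2 < 3)%N.
have e4 := occ_ordered b a (ord 1 isT) (isT : 1 <= 1 < 2)%N.
have e5 : row_count a 1 r * row_count b 2 r = 0.
  rewrite /row_count; case: and3P => [[_ _ /eqP ->]|]; last by rewrite mul0r.
  by rewrite !andbF mulr0.
move: e1 e2 e3 e4 e5; set x1 := row_count a 1 r; set x2 := row_count a 3 r.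
set y := row_count b 2 r; set b0 := occ b 0 w; set b2 := occ b 2 w.
set a1 := occ a 1 w => e1 e2 e3 e4 e5.
have -> : - ((x1 + a1) * (y + b2)) = - (x1 * y) - y * a1 - x1 * b2 - a1 * b2 by ring.
have -> : (x1 - x2) * (b0 - b2) = x1 * b0 - x2 * b0 + x2 * b2 - x1 * b2 by ring.
rewrite e1 e2 e3 e4 e5; ring.
Qed.

(* Coordinate [3 * q + i] belongs to the copies of X_q, to equation [q] or to
   marker [q], according to [i]. *)
Definition generator_entry (k d a b : nat -> nat) (r col : nat) : heisenberg :=
  if (col %% 3 == 0)%N then tie_entry (col %/ 3) (row_var r) (row_kind r)
  else if (col %% 3 == 1)%N then
    equation_entry (k (col %/ 3)%N) (d (col %/ 3)%N) (a (col %/ 3)%N) (b (col %/ 3)%N)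
      (row_var r) (row_kind r)
  else if (col %/ 3 < 3)%N then marker_entry (col %/ 3) (row_var r) (row_kind r)
  else heis 0 0 0.

Definition target_entry (z : nat -> int) (col : nat) : heisenberg :=
  if (col %% 3 == 0)%N then heis 0 0 0
  else if (col %% 3 == 1)%N then heis 0 0 (z (col %/ 3)%N)
  else if (col %/ 3 < 3)%N then heis 0 1 0 else heis 0 0 0.

(** * From a word with the right product to a solution *)

Section System.
Variables (N : nat) (k d a b : nat -> nat) (z : nat -> int).
(** Makes room for the coordinates [3 * i + 2] of the three markers. *)
Hypothesis N3 : (3 <= N)%N.
Hypothesis ltN : forall q, (q < N)%N -> [/\ k q < N, d q < N, a q < N & b q < N]%N.

Definition solution (X : nat -> int) : Prop :=
  X 0%N = 0 /\ forall q, (q < N)%N -> X (k q) = X (d q) + X (a q) * X (b q) + z q.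

Definition good_word (w : seq nat) : Prop :=
  forall col, (col < 3 * N)%N ->
  (\prod_(r <- w) generator_entry k d a b r col)%g = target_entry z col.

Lemma good_wordP w : good_word w <->
  [/\ forall q, (q < N)%N ->
        (\prod_(r <- w) tie_entry q (row_var r) (row_kind r))%g = heis 0 0 0,
      forall q, (q < N)%N ->
        (\prod_(r <- w) equation_entry (k q) (d q) (a q) (b q) (row_var r)
           (row_kind r))%g = heis 0 0 (z q) &
      forall i, (i < 3)%N ->
        (\prod_(r <- w) marker_entry i (row_var r) (row_kind r))%g = heis 0 1 0].
Proof.
split=> [good | [tie eqn mark] col lt_col].
  split=> [q lt_q | q lt_q | i lt_i].
  - have := good (3 * q)%N; rewrite /generator_entry /target_entry.
    by rewrite modnMr /= mulKn //; apply; rewrite ltn_pmul2l.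
  - have := good (3 * q + 1)%N; rewrite /generator_entry /target_entry.
    have -> : ((3 * q + 1) %% 3 = 1)%N by lia.
    have -> : ((3 * q + 1) %/ 3 = q)%N by lia.
    by apply; lia.
  have := good (3 * i + 2)%N; rewrite /generator_entry /target_entry.
  have -> : ((3 * i + 2) %% 3 = 2)%N by lia.
  have -> : ((3 * i + 2) %/ 3 = i)%N by lia.
  by rewrite lt_i; apply; lia.
have lt_q : (col %/ 3 < N)%N by lia.
rewrite /generator_entry /target_entry.
case: eqP => _; first exact: tie.
case: eqP => _; first exact: eqn.
case: ltnP => lt_i; first exact: mark.
by rewrite -heis1 big1_eq.
Qed.

Lemma good_word_solution w : good_word w -> solution (fun j => occ j 1 w).
Proof.
case/good_wordP => tie eqn mark; split=> [|q lt_q].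
  by rewrite /occ big1 // => r _; rewrite /row_count; case: (row_var r).
have ord i : (i < 3)%N -> pairwise (marker_order i) w.
  move=> lt_i; have [u [v [-> fu pv]]] := marker_prod_split lt_i (mark i lt_i).
  exact: split_marker_order.
have [_ _ _ lt_b] := ltN lt_q.
(* The corner entry yields a product of counts in blocks 1 and 2; the tie of X_b turns the latter
   into a count in block 1. *)
have tieb : occ (b q) 1 w = occ (b q) 2 w.
  have := congr1 heis_a (tie _ lt_b); rewrite word_prod !heisE => tieb.
  apply/eqP; rewrite -subr_eq0 -tieb -sumrB; apply/eqP/eq_bigr => r _.
  by case: (tie_entryE (b q) r).
have := congr1 heis_c (eqn q lt_q).
rewrite word_prod !heisE equation_word_cross // tieb => <-.
have -> : word_c (fun r => equation_entry (k q) (d q) (a q) (b q) (row_var r)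
    (row_kind r)) w = occ (k q) 1 w - occ (d q) 1 w.
  rewrite /occ -sumrB; apply: eq_bigr => r _.
  by case: (equation_entryE (k q) (d q) (a q) (b q) r).
ring.
Qed.

(** * From a solution to a word with the right product *)

Section Completeness.
Variables (X : nat -> int) (solX : solution X).

Definition variable_row (B j : nat) : nat := (9 * j + 2 * B + (X j < 0)%R)%N.

Definition variable_block (B : nat) : seq nat :=
  flatten [seq nseq `|X j|%N (variable_row B j) | j <- iota 1 N.-1].

Lemma variable_blockP B r : (B < 4)%N -> r \in variable_block B ->
  [/\ (9 <= r)%N, (r < 9 * N)%N & (row_kind r)./2 = B].
Proof.
move=> lt_B /flatten_mapP[j]; rewrite mem_iota mem_nseq => lt_j /andP[_ /eqP ->].
rewrite /variable_row /row_kind; case: (X j < 0); split=> /=; lia.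
Qed.

Lemma occ_variable_block j B B' : (B < 4)%N -> (j < N)%N ->
  occ j B' (variable_block B) = if B' == B then X j else 0.
Proof.
move=> lt_B lt_j; rewrite /occ /variable_block big_flatten big_map /=.
have rowE i : (0 < i)%N -> \sum_(r <- nseq `|X i|%N (variable_row B i)) row_count j B' r =
    if (i == j) && (B' == B) then X i else 0.
  move=> lt0i; rewrite big_nseq.
  (* For the value 0 the row has sign 1 whereas [Num.sg] is 0; the correction is harmless, as such a
     row is repeated 0 times. *)
  have -> : row_count j B' (variable_row B i) =
     if (i == j) && (B' == B) then Num.sg (X i) + (X i == 0)%:R else 0.
    rewrite /row_count /variable_row /row_var /row_kind.
    have -> : ((9 * i + 2 * B + (X i < 0)%R) %/ 9 = i)%N by case: (X i < 0); lia.
    have -> : ((9 * i + 2 * B + (X i < 0)%R) %% 9 = 2 * B + (X i < 0)%R)%N.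
      by case: (X i < 0); lia.
    have -> : ((2 * B + (X i < 0)%R)./2 = B)%N by case: (X i < 0) => /=; lia.
    rewrite lt0i [B == _]eq_sym /row_sign /=; case: andP => // _.
    have -> : odd (2 * B + (X i < 0)%R) = (X i < 0) by case: (X i < 0) => /=; lia.
    case: (ltrgtP (X i) 0) => [lt|gt|->]; last by rewrite sgr0 add0r.
      by rewrite ltr0_sg ?addr0.
    by rewrite gtr0_sg ?addr0.
  case: andP => // _; last by rewrite iter_addr_0 mul0rn.
  rewrite iter_addr_0; case: eqP => [->|_]; first by rewrite absz0.
  by rewrite addr0 -mulr_natr natz abszE -numEsg.
rewrite big_seq (eq_bigr (fun i => if (i == j) && (B' == B) then X i else 0)); last first.
  by move=> i; rewrite mem_iota => /andP[lt0i _]; rewrite rowE.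
rewrite -big_seq; case: (B' == B); last by rewrite big1 // => i _; rewrite andbF.
under eq_bigr do rewrite andbT.
(* Variable 0 has no rows in the block, in accordance with [X 0 = 0]. *)
rewrite -big_mkcond /=; have [->|j0] := posnP j.
  rewrite big_seq_cond big1 ?(proj1 solX) // => i.
  by rewrite mem_iota => /andP[/andP[lt0i _] /eqP i0]; rewrite i0 in lt0i.
rewrite -big_filter (filter_pred1_uniq (iota_uniq _ _)) ?big_seq1 //.
by rewrite mem_iota; lia.
Qed.

Definition solution_core : seq nat :=
  variable_block 0 ++ 0%N :: variable_block 1 ++ 1%N :: variable_block 2 ++
  2%N :: variable_block 3.

(** A balancing row of one kind is added as often as the core has rows of the opposite kind, so both
    totals become the same sum. Placed at the two ends, these rows never stand on the wrong side of
    a marker. *)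
Definition balance_before : seq nat :=
  flatten [seq nseq (count (must_follow i) solution_core) (3 + i)%N | i <- iota 0 3].
Definition balance_after : seq nat :=
  flatten [seq nseq (count (must_precede i) solution_core) (6 + i)%N | i <- iota 0 3].

Definition solution_word : seq nat :=
  balance_before ++ solution_core ++ balance_after.

Lemma balance_beforeP r : r \in balance_before -> (3 <= r < 6)%N.
Proof.
by move=> /flatten_mapP[j]; rewrite mem_iota mem_nseq => lt_j /andP[_ /eqP ->]; lia.
Qed.

Lemma balance_afterP r : r \in balance_after -> (6 <= r < 9)%N.
Proof.
by move=> /flatten_mapP[j]; rewrite mem_iota mem_nseq => lt_j /andP[_ /eqP ->]; lia.
Qed.

Lemma occ_solution_word j B : (j < N)%N -> (B < 4)%N -> occ j B solution_word = X j.
Proof.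
move=> lt_j lt_B.
have occ0 s : (forall r, r \in s -> (r < 9)%N) -> occ j B s = 0.
  by move=> H; rewrite /occ big_seq big1 // => r /H /row_count_small.
have ob : occ j B balance_before = 0 by apply: occ0 => r /balance_beforeP; lia.
have oa : occ j B balance_after = 0 by apply: occ0 => r /balance_afterP; lia.
rewrite occ_cat ob occ_cat oa /solution_core.
rewrite !(occ_cat, occ_cons) !row_count_small // !occ_variable_block //.
by clear occ0 ob oa; case: B lt_B => [|[|[|[|//]]]] _ /=; rewrite ?add0r ?addr0.
Qed.

Lemma solution_word_balanced i : (i < 3)%N ->
  count (must_follow i) solution_word = count (must_precede i) solution_word.
Proof.
move=> lt_i.
have cb P : count P balance_before =
    \sum_(j <- iota 0 3) (P (3 + j)%N * count (must_follow j) solution_core)%N.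
  rewrite /balance_before count_flatten -map_comp sumnE big_map.
  by apply: eq_bigr => j _; rewrite /= count_nseq.
have ca P : count P balance_after =
    \sum_(j <- iota 0 3) (P (6 + j)%N * count (must_precede j) solution_core)%N.
  rewrite /balance_after count_flatten -map_comp sumnE big_map.
  by apply: eq_bigr => j _; rewrite /= count_nseq.
have cw P : count P solution_word = (count P balance_before +
    (count P solution_core + count P balance_after))%N by rewrite !count_cat.
rewrite !cw !cb !ca /= !big_cons !big_nil /must_follow /must_precede /=.
by case: i lt_i => [|[|[|//]]] _ /=; lia.
Qed.

Ltac split_rows before_f after_p notin_b notin_a notin_blk blkf blkp :=
  rewrite -?catA /= -?catA /= -?catA; split=> //;
  rewrite ?(mem_cat, inE) ?notin_b ?notin_a ?notin_blk //=
    !has_cat /= ?has_cat /= ?has_cat /= ?before_f ?after_p ?orbF /=;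
  apply/negP; do 4?[case/orP];
  first [done | by move/blkf/(_ isT) | by move/blkp/(_ isT)].

Lemma solution_word_split i : (i < 3)%N ->
  exists u v, [/\ solution_word = u ++ i :: v, i \notin u, i \notin v,
                  ~~ has (must_follow i) u & ~~ has (must_precede i) v].
Proof.
move=> lt_i.
have blkf B : has (must_follow i) (variable_block B) -> (B < 4)%N -> (i < B)%N.
  move=> /hasP[r rblk] + lt_B; have [le_r _ rB] := variable_blockP lt_B rblk.
  by rewrite /must_follow rB => /orP[/eqP|/andP[_]] //; lia.
have blkp B : has (must_precede i) (variable_block B) -> (B < 4)%N -> (B <= i)%N.
  move=> /hasP[r rblk] + lt_B; have [le_r _ rB] := variable_blockP lt_B rblk.
  by rewrite /must_precede rB => /orP[/eqP|/andP[_]] //; lia.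
have before_f : has (must_follow i) balance_before = false.
  by apply/hasP => -[r /balance_beforeP H]; rewrite /must_follow; lia.
have after_p : has (must_precede i) balance_after = false.
  by apply/hasP => -[r /balance_afterP H]; rewrite /must_precede; lia.
have notin_blk B : (B < 4)%N -> (i \in variable_block B) = false.
  by move=> lt_B; apply/negP => /variable_blockP[] //; lia.
have notin_b : (i \in balance_before) = false.
  by apply/negP => /balance_beforeP; lia.
have notin_a : (i \in balance_after) = false.
  by apply/negP => /balance_afterP; lia.
rewrite /solution_word /solution_core.
(* From here on the balancing words are arbitrary words with these four properties. *)
move: before_f after_p notin_b notin_a; move: balance_before balance_after.
move=> pre post before_f after_p notin_b notin_a.
case: i lt_i blkf blkp before_f after_p notin_blk notin_b notin_a => [|[|[|//]]] _
  blkf blkp before_f after_p notin_blk notin_b notin_a.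
- exists (pre ++ variable_block 0).
  exists (variable_block 1 ++ 1%N :: variable_block 2 ++ 2%N :: variable_block 3 ++
          post).
  split_rows before_f after_p notin_b notin_a notin_blk blkf blkp.
- exists (pre ++ variable_block 0 ++ 0%N :: variable_block 1).
  exists (variable_block 2 ++ 2%N :: variable_block 3 ++ post).
  split_rows before_f after_p notin_b notin_a notin_blk blkf blkp.
exists (pre ++ variable_block 0 ++ 0%N :: variable_block 1 ++
        1%N :: variable_block 2).
exists (variable_block 3 ++ post).
split_rows before_f after_p notin_b notin_a notin_blk blkf blkp.
Qed.

Lemma solution_word_good : good_word solution_word.
Proof.
apply/good_wordP; split=> [q lt_q | q lt_q | i lt_i].
- rewrite word_prod word_cross0 => [|r _]; last by case: (tie_entryE q r).
  rewrite addr0 /word_b /word_c.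
  congr heis; last by rewrite big1 // => r _; case: (tie_entryE q r).
    transitivity (occ q 1 solution_word - occ q 2 solution_word).
      by rewrite /occ -sumrB; apply: eq_bigr => r _; case: (tie_entryE q r).
    by rewrite !occ_solution_word // subrr.
  by rewrite big1 // => r _; case: (tie_entryE q r).
- have [lt_k lt_d lt_a lt_b] := ltN lt_q.
  rewrite word_prod equation_word_cross => [|i lt_i]; last first.
    by have [u [v [-> _ _ fu pv]]] := solution_word_split lt_i; apply: split_marker_order.
  congr heis.
  + transitivity (occ (a q) 1 solution_word - occ (a q) 3 solution_word).
      rewrite /occ -sumrB; apply: eq_bigr => r _.
      by case: (equation_entryE (k q) (d q) (a q) (b q) r).
    by rewrite !occ_solution_word // subrr.
  + transitivity (occ (b q) 0 solution_word - occ (b q) 2 solution_word).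
      rewrite /occ -sumrB; apply: eq_bigr => r _.
      by case: (equation_entryE (k q) (d q) (a q) (b q) r).
    by rewrite !occ_solution_word // subrr.
  transitivity (occ (k q) 1 solution_word - occ (d q) 1 solution_word
                - occ (a q) 1 solution_word * occ (b q) 2 solution_word).
    congr (_ + _); rewrite /occ -sumrB; apply: eq_bigr => r _.
    by case: (equation_entryE (k q) (d q) (a q) (b q) r).
  rewrite !occ_solution_word // (proj2 solX q lt_q); ring.
have [u [v [e iu iv fu pv]]] := solution_word_split lt_i.
have := solution_word_balanced lt_i.
by rewrite e; apply: split_marker_prod.
Qed.

Lemma solution_word_rows r : r \in solution_word -> (r < 9 * N)%N.
Proof.
rewrite mem_cat => /orP[/balance_beforeP|]; first by lia.
rewrite mem_cat => /orP[|/balance_afterP]; last by lia.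
rewrite !(mem_cat, inE).
by do 6?[case/orP]; first [by case/variable_blockP | move=> /eqP ->; lia].
Qed.

End Completeness.

(** * The finitely generated monoid and membership of the target *)

Definition generator (r : nat) : direct_power (3 * N) :=
  [ffun col : 'I_(3 * N) => generator_entry k d a b r col].
Definition generators : seq (direct_power (3 * N)) :=
  [seq generator r | r <- iota 0 (9 * N)].
Definition target : direct_power (3 * N) :=
  [ffun col : 'I_(3 * N) => target_entry z col].

Definition monoid_of (n : nat) (S : seq (direct_power n)) (x : direct_power n) : Prop :=
  exists2 w : seq (direct_power n), {subset w <= S} & x = (\prod_(y <- w) y)%g.

Lemma prod_generator w (col : 'I_(3 * N)) :
  (\prod_(y <- [seq generator r | r <- w]) y)%g col =
  (\prod_(r <- w) generator_entry k d a b r col)%g.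
Proof.
elim: w => [|r w IHw]; first by rewrite !big_nil ffunE.
by rewrite /= !big_cons ffunE IHw ffunE.
Qed.

Lemma target_in_monoid : monoid_of generators target <-> exists X, solution X.
Proof.
have good_prod w : good_word w <-> target = (\prod_(y <- [seq generator r | r <- w]) y)%g.
  split=> [good | e col lt_col].
    by apply/ffunP => col; rewrite prod_generator good // ffunE.
  by have /ffunP/(_ (Ordinal lt_col)) := e; rewrite prod_generator ffunE.
split=> [[w sub_w e] | [X solX]].
  (* A word in the generators is lifted to a word of row numbers; any choice of preimages will
     do. *)
  suff [w' ew] : exists w', w = [seq generator r | r <- w'].
    by exists (fun j => occ j 1 w'); apply/good_word_solution/good_prod; rewrite -ew.
  elim: w sub_w {e} => [|y w IHw] sub_w; first by exists [::].
  have /mapP[r _ ->] := sub_w y (mem_head _ _).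
  have [|w' ->] := IHw; first by move=> x xw; apply: sub_w; rewrite inE xw orbT.
  by exists (r :: w').
exists [seq generator r | r <- solution_word X].
  move=> y /mapP[r rw ->]; apply: map_f; rewrite mem_iota /=.
  exact: solution_word_rows rw.
exact/good_prod/solution_word_good.
Qed.

End System.

Lemma monoid_of_submonoid n (S : seq (direct_power n)) : submonoid (monoid_of S).
Proof.
split=> [|x y [u uS ->] [v vS ->]]; first by exists [::]; rewrite ?big_nil.
exists (u ++ v); last by rewrite big_cat.
by move=> s; rewrite mem_cat => /orP[/uS | /vS].
Qed.

(** * The system of equations of a polynomial *)

(* [L] is the code of the list of terms of the polynomial.  Variable [3 * u] with
   [u = code_cons i x] is the value at zeta_i, zeta_(i+1), ... of the monomial
   whose exponents are listed by [x]; variable [3 * u + 1] is the integer of code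
   [u]; variable [3 * u + 2] is the sum of the terms listed by [u].  Equation [q]
   defines variable [q], except that equation [0] states D = upsilon and that the
   equation of [3 * code_cons i 2], the variable of zeta_i itself, is void. *)
Section Program.
Variable L : nat.

Definition prog_k (q : nat) : nat :=
  if q == 0%N then (3 * L + 2)%N
  else if (q %% 3 == 0)%N && (code_tail (q %/ 3) == 2)%N then 0%N else q.

(** An odd exponent code x starts with the exponent 0, and [x./2] codes the remaining exponents,
    read from the next variable on. For a sum of terms, the summand is the sum of all terms but the
    first. *)
Definition prog_d (q : nat) : nat :=
  if (q %% 3 == 0)%N then
    if odd (code_tail (q %/ 3)) then
      (3 * code_cons (code_head (q %/ 3)).+1 (code_tail (q %/ 3))./2)%N
    else 0%N
  else if (q %% 3 == 2)%N then
    if (q %/ 3 == 0)%N then 0%N else (3 * code_tail (q %/ 3) + 2)%N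
  else 0%N.

(** In an even exponent code x > 2 the first exponent is positive, and [x./2] lowers it by 1; the
    factor split off is zeta_i, with exponent list [:: 1] of code 2. For a sum, the product is the
    first term, coefficient times monomial. *)
Definition prog_a (q : nat) : nat :=
  if (q %% 3 == 0)%N then
    if odd (code_tail (q %/ 3)) || (code_tail (q %/ 3) <= 2)%N then 0%N
    else (3 * code_cons (code_head (q %/ 3)) 2)%N
  else if (q %% 3 == 2)%N then
    if (q %/ 3 == 0)%N then 0%N else (3 * code_head (code_head (q %/ 3)) + 1)%N
  else 0%N.

Definition prog_b (q : nat) : nat :=
  if (q %% 3 == 0)%N then
    if odd (code_tail (q %/ 3)) || (code_tail (q %/ 3) <= 2)%N then 0%N
    else (3 * code_cons (code_head (q %/ 3)) (code_tail (q %/ 3))./2)%N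
  else if (q %% 3 == 2)%N then
    if (q %/ 3 == 0)%N then 0%N
    else (3 * code_cons 0 (code_head (code_tail (code_head (q %/ 3)))))%N
  else 0%N.

(** The right-hand side upsilon, coded by [v], enters only here, and these constants occur only in
    the target; the generators thus depend on the polynomial alone. *)
Definition prog_z (v q : nat) : int :=
  if q == 0%N then uncode_int v
  else if (q %% 3 == 1)%N then uncode_int (q %/ 3)
  else if (q %% 3 == 0)%N && (code_tail (q %/ 3) == 0)%N then 1 else 0.

Definition prog_size : nat := (3 * L + 3)%N.

Lemma code_head0 : code_head 0 = 0%N. Proof. by []. Qed.
Lemma code_tail0 : code_tail 0 = 0%N. Proof. by []. Qed.

Lemma code_cons_gt h x : (h < code_cons h x)%N /\ (x < code_cons h x)%N.
Proof.
rewrite /code_cons; have := ltn_expl h (isT : 1 < 2)%N.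
by split; nia.
Qed.

Lemma code_cons3_neq0 h x : (3 * code_cons h x == 0)%N = false.
Proof. by rewrite /code_cons !muln_eq0 expn_eq0. Qed.

Lemma code_head_lt n : (0 < n)%N -> (code_head n < n)%N.
Proof.
by case: (codeP n) => // h x _; rewrite code_headK; case: (code_cons_gt h x).
Qed.

Lemma code_tail_lt n : (0 < n)%N -> (code_tail n < n)%N.
Proof.
by case: (codeP n) => // h x _; rewrite code_tailK; case: (code_cons_gt h x).
Qed.

Lemma code_cons_mono h x y : (x <= y)%N -> (code_cons h x <= code_cons h y)%N.
Proof. by move=> le_xy; rewrite /code_cons leq_mul2l ltnS leq_double le_xy orbT. Qed.

Lemma code_cons_half h x : odd x -> (code_cons h.+1 x./2 <= code_cons h x)%N.
Proof.
move=> odd_x; rewrite -[x in leqRHS]odd_double_half odd_x /code_cons expnS.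
by rewrite [(2 * _)%N]mulnC -mulnA leq_mul2l; apply/orP; right; lia.
Qed.

(** The exponent code m is nested inside the code h of the first term, so that 2m + 1 < h < u;
    missing components read as 0. *)
Lemma code_monomial_le u : (0 < u)%N ->
  (code_cons 0 (code_head (code_tail (code_head u))) <= u)%N.
Proof.
have cons0 n : code_cons 0 n = n.*2.+1 by rewrite /code_cons mul1n.
case: (codeP u) => // h x _; rewrite code_headK cons0.
have [lt_h _] := code_cons_gt h x.
case: (codeP h) lt_h => [|c y]; first by rewrite code_tail0 code_head0; lia.
rewrite code_tailK => lt_h.
case: (codeP y) lt_h => [|m y']; first by rewrite code_head0; lia.
rewrite code_headK; have [lt_m _] := code_cons_gt m y'.
have : ((code_cons m y').*2.+1 <= code_cons c (code_cons m y'))%N.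
  by rewrite -[leqLHS]mul1n leq_mul2r expn_gt0 orbT.
by lia.
Qed.

(** Apart from equation 0, an equation with quotient u = [q %/ 3] refers only to variables of
    quotient at most u, so the variables of quotient at most L form a closed system. *)
Lemma prog_lt q : (q < prog_size)%N ->
  [/\ prog_k q < prog_size, prog_d q < prog_size,
      prog_a q < prog_size & prog_b q < prog_size]%N.
Proof.
move=> lt_q; have := divn_eq q 3; have := ltn_pmod q (isT : 0 < 3)%N.
rewrite /prog_k /prog_d /prog_a /prog_b.
have le_L : (q %/ 3 <= L)%N by rewrite /prog_size in lt_q; lia.
move: (q %/ 3)%N (q %% 3)%N le_L => u r le_L lt_r eq_q; rewrite /prog_size in lt_q *.
have ht : (0 < u)%N -> (code_head (code_head u) < u)%N.
  move=> u0; have := code_head_lt u0.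
  have [->|h0] := posnP (code_head u); first by rewrite code_head0.
  by move/(ltn_trans (code_head_lt h0)).
split.
- by case: eqP => _; [lia | case: ifP => _; lia].
- case: eqP => [r0|_].
    case: (codeP u) le_L eq_q => [|h x] le_L eq_q; first by rewrite code_tail0 /=; lia.
    rewrite code_headK code_tailK; case: ifP => [odd_x|_]; last by lia.
    by have := code_cons_half h odd_x; lia.
  case: eqP => _; last by lia.
  by case: posnP => u0; [lia | have := code_tail_lt u0; lia].
- case: eqP => [r0|_].
    case: (codeP u) le_L eq_q => [|h x] le_L eq_q; first by rewrite code_tail0 /=; lia.
    rewrite code_headK code_tailK; case: ifP => [_|]; first by lia.
    move/negbT; rewrite negb_or -ltnNge => /andP[_ lt_x].
    by have := code_cons_mono h (ltnW lt_x); lia.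
  case: eqP => _; last by lia.
  by case: posnP => u0; [lia | have := ht u0; lia].
case: eqP => [r0|_].
  case: (codeP u) le_L eq_q => [|h x] le_L eq_q; first by rewrite code_tail0 /=; lia.
  rewrite code_headK code_tailK; case: ifP => [_|_]; first by lia.
  have /(code_cons_mono h) : (x./2 <= x)%N by lia.
  by lia.
case: eqP => _; last by lia.
by case: posnP => u0; [lia | have := code_monomial_le u0; lia].
Qed.

End Program.

(** * Solutions of the system and values of the polynomial *)

Fixpoint monomial_value (zeta : nat -> int) (i : nat) (s : seq nat) : int :=
  if s is e :: s' then zeta i ^+ e * monomial_value zeta i.+1 s' else 1.

Definition term_value (zeta : nat -> int) (h : nat) : int :=
  uncode_int (code_head h) *
  monomial_value zeta 0 (CodeSeq.decode (code_head (code_tail h))).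

Definition terms_value (zeta : nat -> int) (s : seq nat) : int :=
  \sum_(h <- s) term_value zeta h.

Lemma decode_code_cons h x : CodeSeq.decode (code_cons h x) = h :: CodeSeq.decode x.
Proof. by rewrite -[x in LHS]CodeSeq.decodeK code_cons_code CodeSeq.codeK. Qed.

Lemma code_cons0 x : code_cons 0 x = x.*2.+1.
Proof. by rewrite /code_cons mul1n. Qed.

Lemma code_consS h x : code_cons h.+1 x = (code_cons h x).*2.
Proof. by rewrite /code_cons expnS -mulnA mul2n. Qed.

Section Solutions.
Variables (L v : nat).
Let sol := solution (prog_size L) (prog_k L) prog_d prog_a prog_b (prog_z v).

Lemma solution_terms X : sol X ->
  exists zeta, terms_value zeta (CodeSeq.decode L) = uncode_int v.
Proof.
(* The integers sought are the values of the variables whose own equations are void. *)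
case=> X0 eqX; pose zeta i := X (3 * code_cons i 2)%N; exists zeta.
have monX s i : (code_cons i (CodeSeq.code s) <= L)%N ->
    X (3 * code_cons i (CodeSeq.code s))%N = monomial_value zeta i s.
  elim: s i => [|e s IHs] i le_L.
    have := eqX (3 * code_cons i 0)%N; rewrite /prog_k /prog_d /prog_a /prog_b /prog_z.
    rewrite modnMr mulKn // code_headK code_tailK /= X0; rewrite /= in le_L.
    rewrite code_cons3_neq0.
    by move->; [rewrite mul0r !add0r | rewrite /prog_size; lia].
  rewrite -code_cons_code in le_L *; elim: e le_L => [|e IHe] le_L.
    have := eqX (3 * code_cons i (code_cons 0 (CodeSeq.code s)))%N.
    rewrite /prog_k /prog_d /prog_a /prog_b /prog_z.
    rewrite modnMr mulKn // code_headK code_tailK code_cons0 /= odd_double /=.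
    rewrite uphalf_double !eqSS X0 mul0r !addr0.
    have -> : ((CodeSeq.code s).*2 == 1)%N = false by lia.
    rewrite code_cons0 in le_L.
    have le' : (code_cons i.+1 (CodeSeq.code s) <= L)%N.
      apply: leq_trans le_L; have := @code_cons_half i (CodeSeq.code s).*2.+1.
      by rewrite /= odd_double uphalf_double; apply.
    rewrite code_cons3_neq0.
    by move->; [rewrite addr0 expr0 mul1r IHs | rewrite /prog_size; lia].
  move: IHe le_L; rewrite code_consS; set y := code_cons e _ => IHe le_L.
  have y0 : (0 < y)%N by have := code_cons_gt e (CodeSeq.code s); rewrite /y; lia.
  have le_y : (code_cons i y <= L)%N.
    by apply: leq_trans le_L; apply: code_cons_mono; lia.
  (* The code 1 is that of [:: 0]; the list at hand is then [:: 1], whose variable is [zeta i] by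
     definition. *)
  have [y1|y1] := leqP y 1.
    have ey : y = 1%N by lia.
    have [e0 s0] : e = 0%N /\ CodeSeq.code s = 0%N.
      by have := code_cons_gt e (CodeSeq.code s); rewrite -/y ey; lia.
    have -> : s = [::] by rewrite -[s]CodeSeq.codeK s0.
    by rewrite e0 ey /= expr1 mulr1.
  have := eqX (3 * code_cons i y.*2)%N.
  rewrite /prog_k /prog_d /prog_a /prog_b /prog_z.
  rewrite modnMr mulKn // code_headK code_tailK odd_double /= doubleK.
  rewrite code_cons3_neq0.
  have -> : (y.*2 == 2)%N = false by lia.
  have -> : (y.*2 <= 2)%N = false by lia.
  have -> : (y.*2 == 0)%N = false by lia.
  rewrite X0 add0r addr0 => -> ; last by rewrite /prog_size; lia.
  by rewrite IHe // [in RHS]/= exprS mulrA.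
have termX s : (CodeSeq.code s <= L)%N ->
    X (3 * CodeSeq.code s + 2)%N = terms_value zeta s.
  rewrite /terms_value; elim: s => [|h s IHs] le_L.
    rewrite big_nil; have := eqX 2%N; rewrite /prog_k /prog_d /prog_a /prog_b /prog_z /=.
    by rewrite X0; move->; [rewrite mul0r !addr0 | rewrite /prog_size; lia].
  rewrite big_cons -code_cons_code in le_L *; set u := code_cons h _ in le_L *.
  have [lt_h lt_s] := code_cons_gt h (CodeSeq.code s); rewrite -/u in lt_h lt_s.
  have u0 : (0 < u)%N by lia.
  have := eqX (3 * u + 2)%N; rewrite /prog_k /prog_d /prog_a /prog_b /prog_z.
  have -> : ((3 * u + 2) %% 3 = 2)%N by lia.
  have -> : ((3 * u + 2) %/ 3 = u)%N by lia.
  have -> : (3 * u + 2 == 0)%N = false by lia.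
  have -> : (u == 0)%N = false by lia.
  rewrite /= /u code_headK code_tailK -/u => ->; last by rewrite /prog_size; lia.
  rewrite addr0 IHs; last by lia.
  rewrite [RHS]addrC; congr (_ + _); rewrite /term_value; congr (_ * _).
    have lt_c : (code_head h < u)%N.
      have [->|h0] := posnP h; first by rewrite code_head0.
      by have := code_head_lt h0; lia.
    have := eqX (3 * code_head h + 1)%N; rewrite /prog_k /prog_d /prog_a /prog_b /prog_z.
    have -> : ((3 * code_head h + 1) %% 3 = 1)%N by lia.
    have -> : ((3 * code_head h + 1) %/ 3 = code_head h)%N by lia.
    have -> : (3 * code_head h + 1 == 0)%N = false by lia.
    by rewrite /= X0; move->; [rewrite mul0r !add0r | rewrite /prog_size; lia].
  rewrite -[code_head (code_tail h) in LHS]CodeSeq.decodeK monX //.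
  rewrite CodeSeq.decodeK; apply: leq_trans le_L.
  by have := code_monomial_le u0; rewrite /u code_headK.
rewrite -termX CodeSeq.decodeK //.
have := eqX 0%N; rewrite /prog_k /prog_d /prog_a /prog_b /prog_z /= X0.
by move->; [rewrite mul0r !add0r | rewrite /prog_size; lia].
Qed.

Lemma terms_solution zeta :
  terms_value zeta (CodeSeq.decode L) = uncode_int v -> exists X, sol X.
Proof.
move=> eqv.
(* Every variable gets its intended meaning; index 0, which is no [3 * code_cons i x], is the
   blank. *)
pose X q := if q == 0%N then 0 else
  if (q %% 3 == 0)%N then
    monomial_value zeta (code_head (q %/ 3)) (CodeSeq.decode (code_tail (q %/ 3)))
  else if (q %% 3 == 1)%N then uncode_int (q %/ 3)
  else terms_value zeta (CodeSeq.decode (q %/ 3)).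
have X0 : X 0%N = 0 by [].
have Xmon i x : X (3 * code_cons i x)%N = monomial_value zeta i (CodeSeq.decode x).
  rewrite /X modnMr mulKn // code_headK code_tailK /=.
  by rewrite code_cons3_neq0.
have Xcst c : X (3 * c + 1)%N = uncode_int c.
  rewrite /X; have -> : ((3 * c + 1) %% 3 = 1)%N by lia.
  have -> : ((3 * c + 1) %/ 3 = c)%N by lia.
  by have -> : (3 * c + 1 == 0)%N = false by lia.
have Xsum u : X (3 * u + 2)%N = terms_value zeta (CodeSeq.decode u).
  rewrite /X; have -> : ((3 * u + 2) %% 3 = 2)%N by lia.
  have -> : ((3 * u + 2) %/ 3 = u)%N by lia.
  by have -> : (3 * u + 2 == 0)%N = false by lia.
exists X; split=> // q lt_q.
rewrite /prog_k /prog_d /prog_a /prog_b /prog_z.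
have [-> | q0] := posnP q.
  by rewrite /= Xsum X0 mul0r !add0r.
have := divn_eq q 3; have := ltn_pmod q (isT : 0 < 3)%N.
move: (q %/ 3)%N (q %% 3)%N => u r lt_r eq_q.
case: r lt_r eq_q => [|[|[|//]]] _ eq_q /=.
- have -> : q = (3 * u)%N by lia.
  case: (codeP u) eq_q => [|i x] eq_q; first by lia.
  rewrite code_headK code_tailK.
  have [->|x2] := eqVneq x 2%N; first by rewrite /= X0 mul0r !addr0.
  rewrite Xmon; case: (codeP x) x2 => [|[|e] y] x2.
  + by rewrite /= X0 mul0r !add0r.
  + rewrite decode_code_cons code_cons0 /= odd_double /= X0 mul0r !addr0.
    by rewrite uphalf_double Xmon expr0 mul1r.
  rewrite code_consS in x2 *; have [y0 _] := code_cons_gt e y.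
  rewrite odd_double /=.
  have -> : ((code_cons e y).*2 <= 2)%N = false by lia.
  have -> : ((code_cons e y).*2 == 0)%N = false by lia.
  rewrite X0 add0r addr0 doubleK !Xmon -code_consS !decode_code_cons.
  rewrite -[2%N]/(code_cons 1 0) decode_code_cons /= expr1 mulr1 exprS mulrA //.
- have -> : q = (3 * u + 1)%N by lia.
  by rewrite Xcst X0 mul0r !add0r.
have -> : q = (3 * u + 2)%N by lia.
rewrite Xsum; case: (codeP u) => [|h x]; first by rewrite /terms_value big_nil X0 mul0r !addr0.
have -> : (code_cons h x == 0)%N = false by have := code_cons_gt h x; lia.
rewrite code_headK code_tailK Xsum Xcst Xmon decode_code_cons /terms_value big_cons.
by rewrite addr0 addrC.
Qed.

End Solutions.

Lemma monomial_valueE zeta i s :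
  monomial_value zeta i s = \prod_(0 <= j < size s) zeta (i + j)%N ^+ nth 0%N s j.
Proof.
elim: s i => [|e s IHs] i; first by rewrite big_nil.
rewrite /= big_nat_recl // addn0; congr (_ * _); rewrite IHs.
by apply: eq_bigr => j _; rewrite addSnnS.
Qed.

Definition code_terms (t : nat) (D : {mpoly int[t]}) : seq nat :=
  [seq CodeSeq.code [:: code_int D@_m; code_monomial m] | m <- sort <=%O (msupp D)].

Lemma code_poly_terms t (D : {mpoly int[t]}) :
  CodeSeq.decode (code_head (code_tail (code_poly D))) = code_terms D.
Proof. by rewrite /code_poly -!code_cons_code code_tailK code_headK CodeSeq.codeK. Qed.

Lemma terms_value_meval t (D : {mpoly int[t]}) zeta :
  terms_value zeta (code_terms D) = D.@[fun i => zeta i].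
Proof.
rewrite mevalE /terms_value big_map.
have perm_supp : perm_eq (sort <=%O (msupp D)) (msupp D) by rewrite perm_sort.
rewrite (perm_big _ perm_supp).
apply: eq_bigr => m _; rewrite /term_value -!code_cons_code code_tailK !code_headK.
rewrite code_intK /code_monomial CodeSeq.codeK monomial_valueE.
rewrite size_map size_enum_ord big_mkord; congr (_ * _); apply: eq_bigr => i _.
by rewrite add0n (nth_map i) ?size_enum_ord // nth_ord_enum.
Qed.

Lemma solution_meval t (D : {mpoly int[t]}) (upsilon : int)
    (L := code_head (code_tail (code_poly D))) :
  (exists X, solution (prog_size L) (prog_k L) prog_d prog_a prog_b
               (prog_z (code_int upsilon)) X) <->
  (exists zeta : 'I_t -> int, D.@[zeta] = upsilon).
Proof.
split=> [[X /solution_terms[zeta]] | [zeta eqD]].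
  rewrite code_poly_terms terms_value_meval code_intK => eqD.
  by exists (fun i => zeta i).
(* Indices beyond the variables of the polynomial get the value 0. *)
pose zeta' j := if insub j is Some i then zeta i else 0.
apply: (@terms_solution _ _ zeta').
rewrite code_poly_terms terms_value_meval code_intK -eqD.
by apply: meval_eq => i; rewrite /zeta' valK.
Qed.

(** * Computability of the construction *)

(** Follows the syntax of the function; the rules for conditionals come last, as a fallback for
    bodies with none of the listed head symbols. *)
Ltac prove_rec := repeat
  (first [apply: rec_fun_const | apply: rec_int_const | lazymatch goal with
  | |- rec_fun (fun s => nth 0%N s ?i) => apply: rec_fun_nth
  | |- rec_fun (fun s => S (@?F s)) => apply: (@rec_fun_succ F)
  | |- rec_fun (fun s => addn (@?F s) (@?G s)) => apply: (@rec_fun_add F G)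
  | |- rec_fun (fun s => muln (@?F s) (@?G s)) => apply: (@rec_fun_mul F G)
  | |- rec_fun (fun s => modn (@?F s) ?m) => apply: (@rec_fun_modn _ F)
  | |- rec_fun (fun s => divn (@?F s) ?m) => apply: (@rec_fun_divn _ F)
  | |- rec_fun (fun s => half (@?F s)) => apply: (@rec_fun_half F)
  | |- rec_fun (fun s => code_head (@?F s)) => apply: (@rec_fun_code_head F)
  | |- rec_fun (fun s => code_tail (@?F s)) => apply: (@rec_fun_code_tail F)
  | |- rec_fun (fun s => code_cons (@?F s) (@?G s)) => apply: (@rec_fun_code_cons F G)
  | |- rec_pred (fun s => andb (@?P s) (@?Q s)) => apply: (@rec_pred_and P Q)
  | |- rec_pred (fun s => orb (@?P s) (@?Q s)) => apply: (@rec_pred_or P Q)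
  | |- rec_pred (fun s => negb (@?P s)) => apply: (@rec_pred_neg P)
  | |- rec_pred (fun s => leq (@?F s) (@?G s)) => apply: (@rec_pred_leq F G)
  | |- rec_pred (fun s => eq_op (@?F s) (@?G s)) => apply: (@rec_pred_eq F G)
  | |- rec_pred (fun s => odd (@?F s)) => apply: (@rec_pred_odd F)
  | |- rec_int (fun s => uncode_int (@?F s)) => apply: (@rec_int_uncode F)
  | |- rec_int (fun s => GRing.opp (@?F s)) => apply: (@rec_int_opp F)
  | |- rec_heis (fun s => heis (@?F s) (@?G s) (@?H s)) => apply: (@rec_heis_heis F G H)
  | |- rec_fun _ => apply: rec_fun_if
  | |- rec_int _ => apply: rec_int_if
  | |- rec_heis _ => apply: rec_heis_if
  end]).

(** Skips the number of variables, which comes first in the code, and keeps the list of terms. *)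
Definition poly_terms_code (c : nat) : nat := code_head (code_tail c).

Definition generators_code (s : seq nat) : nat :=
  let L := poly_terms_code (nth 0%N s 0) in
  code_cons (3 * prog_size L) (code_cons
    (CodeSeq.code (mkseq (fun r => CodeSeq.code (mkseq (fun col =>
       code_heisenberg (generator_entry (prog_k L) prog_d prog_a prog_b r col))
     (3 * prog_size L))) (9 * prog_size L))) 0).

Definition target_code (s : seq nat) : nat :=
  CodeSeq.code (mkseq (fun col => code_heisenberg (target_entry (prog_z (nth 0%N s 1)) col))
    (3 * prog_size (poly_terms_code (nth 0%N s 0)))).

Lemma rec_generators_code : rec_fun generators_code.
Proof.
(* Each of the two nested [mkseq] puts its index in front: the column is at position 0, the row at
   1, the polynomial at 2. *)
have rentry : rec_fun (fun s => code_heisenberg (generator_entry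
    (prog_k (poly_terms_code (nth 0%N s 2))) prog_d prog_a prog_b
    (nth 0%N s 1) (nth 0%N s 0))).
  rewrite -/(rec_heis _) /generator_entry /tie_entry /equation_entry /marker_entry.
  rewrite /row_sign /row_var /row_kind /prog_k /prog_d /prog_a /prog_b /poly_terms_code.
  prove_rec.
have rsize i m : rec_fun (fun s => m * prog_size (poly_terms_code (nth 0 s i)))%N.
  by rewrite /prog_size /poly_terms_code; prove_rec.
have rrow := rec_fun_code_mkseq (rsize 1 3) rentry.
have rows := rec_fun_code_mkseq (rsize 0 9) rrow.
exact: rec_fun_code_cons (rsize 0 3) (rec_fun_code_cons rows (rec_fun_const 0)).
Qed.

Lemma rec_target_code : rec_fun target_code.
Proof.
(* With the column in front, the polynomial moves to position 1 and upsilon to position 2. *)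
have rentry : rec_fun (fun s => code_heisenberg (target_entry
    (prog_z (nth 0%N s 2)) (nth 0%N s 0))).
  by rewrite -/(rec_heis _) /target_entry /prog_z; prove_rec.
have rsize : rec_fun (fun s => 3 * prog_size (poly_terms_code (nth 0 s 0)))%N.
  by rewrite /prog_size /poly_terms_code; prove_rec.
exact: rec_fun_code_mkseq rsize rentry.
Qed.

Lemma code_element_ffun n (F : nat -> heisenberg) :
  code_element ([ffun i : 'I_n => F i] : direct_power n) =
  CodeSeq.code (mkseq (fun i => code_heisenberg (F i)) n).
Proof.
rewrite /code_element /mkseq -val_enum_ord -map_comp.
by congr CodeSeq.code; apply: eq_map => i /=; rewrite ffunE.
Qed.

Theorem theorem5p1 :
  exists (fM : 1.-tuple nat -> nat) (fg : 2.-tuple nat -> nat),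
    recursive fM /\ recursive fg /\
    forall (t : nat) (D : {mpoly int[t]}), D@_0%MM = 0 ->
    exists (n : nat) (M : direct_power n -> Prop) (S : seq (direct_power n)),
      (0 < n)%N /\
      submonoid M /\ generated_by M S /\
      fM [tuple code_poly D] = code_generators S /\
      forall upsilon : int,
      exists g : direct_power n,
        fg [tuple code_poly D; code_int upsilon] = code_element g /\
        ((exists zeta : 'I_t -> int, D.@[zeta] = upsilon) <-> M g).
Proof.
exists (fun x => generators_code x), (fun x => target_code x).
split; first exact: rec_generators_code.
split; first exact: rec_target_code.
move=> t D _; pose L := poly_terms_code (code_poly D); pose N := prog_size L.
pose S := generators N (prog_k L) prog_d prog_a prog_b.
exists (3 * N)%N, (monoid_of S), S; split; first by rewrite /N /prog_size; lia.
split; first exact: monoid_of_submonoid.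
split; first by [].
split.
  rewrite /generators_code /= -/L -/N /code_generators /S /generators -map_comp.
  rewrite -[0%N in LHS]/(CodeSeq.code [::]) !code_cons_code.
  congr (CodeSeq.code [:: _; CodeSeq.code _]); apply: eq_map => r /=.
  by rewrite /generator code_element_ffun.
(* The monoid is fixed before upsilon is introduced; only the target varies with it. *)
move=> upsilon; exists (target N (prog_z (code_int upsilon))).
split; first by rewrite /target code_element_ffun.
rewrite -solution_meval; apply: iff_sym; apply: target_in_monoid => [|q lt_q].
  by rewrite /N /prog_size; lia.
exact: prog_lt.
Qed.
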